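(* Let $\mathcal{B}$ be a $C^*$-algebra and let $K$ be a closed ideal in a Hilbert $\mathcal{B}$-module $E$. Then the quotient $\mathcal{B}$-module $E/K$ admits a $\mathcal{B}$-valued inner product turning it isometrically into a Hilbert $\mathcal{B}$-module (that is, such that the norm induced by the inner product is the quotient norm of $E/K$) if and only if $K$ is complemented in $E$, i.e. $E=K\oplus K^\perp$.
   Context: Hilbert modules are right modules with $\mathcal{B}$-valued inner product, linear in the second variable. A closed ideal in a Hilbert $\mathcal{B}$-module $E$ is a closed linear subspace $K\subset E$ with $x\langle k,y\rangle\in K$ for all $x,y\in E$, $k\in K$ (equivalently, $K=\overline{\mathrm{span}}\,\{xi:x\in E,i\in I\}$ for some closed two-sided ideal $I$ of $\mathcal{B}$); it is automatically a $\mathcal{B}$-submodule. $E/K$ carries the $\mathcal{B}$-module structure $(x+K)b=xb+K$ and the quotient norm $\|x+K\|=\inf_{k\in K}\|x+k\|$. $K^\perp=\{x\in E:\langle x,k\rangle=0\ \forall k\in K\}$. *)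

(* Defs.v *)
From HB Require Import structures.
From mathcomp Require Import all_boot all_order all_algebra.
From mathcomp Require Import ring_quotient complex.
From mathcomp Require Import all_classical all_reals all_analysis.
From mathcomp Require Import ring.
Set Implicit Arguments.
Unset Strict Implicit.
Unset Printing Implicit Defensive.
Import Order.TTheory GRing.Theory Num.Theory.
Import numFieldNormedType.Exports.
Local Open Scope classical_set_scope.
Local Open Scope complex_scope.
Local Open Scope ring_scope.

(* Algebras are not assumed to be unital, so the product is not the one of a
   MathComp ring. *)
HB.mixin Record isCStarAlgebra (R : realType) B
    & CompleteNormedModule R[i] B := {
  amul : B -> B -> B;
  star : B -> B;
  amulA : associative amul;
  amulDl : forall a b c, amul (a + b) c = amul a c + amul b c;
  amulDr : forall a b c, amul a (b + c) = amul a b + amul a c;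
  amulZl : forall (z : R[i]) a b, amul (z *: a) b = z *: amul a b;
  amulZr : forall (z : R[i]) a b, amul a (z *: b) = z *: amul a b;
  starD : forall a b, star (a + b) = star a + star b;
  starZ : forall (z : R[i]) a, star (z *: a) = z^* *: star a;
  starM : forall a b, star (amul a b) = amul (star b) (star a);
  starK : involutive star;
  norm_amul : forall a b, `|amul a b| <= `|a| * `|b|;
  norm_starM : forall a, `|amul (star a) a| = `|a| ^+ 2
}.

#[short(type="cstarAlgType")]
HB.structure Definition CStarAlgebra (R : realType) :=
  {B of CompleteNormedModule R[i] B & isCStarAlgebra R B}.

Declare Scope cstar_scope.
Delimit Scope cstar_scope with cstar.
Local Open Scope cstar_scope.
Notation "a ** b" := (amul a b) (at level 40, left associativity) : cstar_scope.

HB.mixin Record isRightModule (R : realType) (B : cstarAlgType R) V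
    & GRing.Lmodule R[i] V := {
  ract : V -> B -> V;
  ractDl : forall x y b, ract (x + y) b = ract x b + ract y b;
  ractDr : forall x b c, ract x (b + c) = ract x b + ract x c;
  ractZl : forall (z : R[i]) x b, ract (z *: x) b = z *: ract x b;
  ractZr : forall (z : R[i]) x b, ract x (z *: b) = z *: ract x b;
  ractA : forall x b c, ract x (b ** c) = ract (ract x b) c
}.

#[short(type="rightModType")]
HB.structure Definition RightModule (R : realType) (B : cstarAlgType R) :=
  {V of GRing.Lmodule R[i] V & isRightModule R B V}.

#[short(type="normedRightModType")]
HB.structure Definition NormedRightModule (R : realType) (B : cstarAlgType R) :=
  {V of NormedModule R[i] V & isRightModule R B V}.

Notation "x <.> b" := (ract x b) (at level 40, left associativity) : cstar_scope.

(* Conjugate linearity in the first variable follows from [ip_star]; the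
   positive elements of a C*-algebra are those of the form b^* b. *)
Record inner_product (R : realType) (B : cstarAlgType R) (V : rightModType B)
    (ip : V -> V -> B) : Prop := InnerProduct {
  ipDr : forall x y z, ip x (y + z) = ip x y + ip x z;
  ipZr : forall (c : R[i]) x y, ip x (c *: y) = c *: ip x y;
  ip_ract : forall x y b, ip x (y <.> b) = ip x y ** b;
  ip_star : forall x y, star (ip x y) = ip y x;
  ip_ge0 : forall x, exists b, ip x x = star b ** b;
  ip_eq0 : forall x, ip x x = 0 -> x = 0
}.

(* [ip] turns the normed right module [V] isometrically into a Hilbert module:
   the given norm of [V] is the one induced by [ip], and [V] is complete. *)
Definition hilbert_product (R : realType) (B : cstarAlgType R)
    (V : normedRightModType B) (ip : V -> V -> B) : Prop :=
  [/\ inner_product ip,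
      forall x, `|x| = sqrtC `|ip x x|
    & forall F : set_system V, ProperFilter F -> cauchy F -> cvg F].

HB.mixin Record isHilbertModule (R : realType) (B : cstarAlgType R) V
    & NormedRightModule R B V := {
  inner : V -> V -> B;
  innerP : hilbert_product inner
}.

#[short(type="hilbertModType")]
HB.structure Definition HilbertModule (R : realType) (B : cstarAlgType R) :=
  {V of NormedRightModule R B V & isHilbertModule R B V}.

Notation "'<< x , y >>" := (inner x y)
  (at level 0, x, y at level 99, format "''<<' x ,  y '>>'") : cstar_scope.

Section ClosedIdeal.
Context {R : realType} {B : cstarAlgType R}.

Record closedIdeal (E : hilbertModType B) := ClosedIdeal {
  ideal_set :> set E;
  ideal_closed : closed ideal_set;
  ideal0 : ideal_set 0;
  idealD : forall k l, ideal_set k -> ideal_set l -> ideal_set (k + l);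
  idealZ : forall (z : R[i]) k, ideal_set k -> ideal_set (z *: k);
  ideal_inner : forall x k y, ideal_set k -> ideal_set (x <.> '<<k, y>>)
}.

Variable E : hilbertModType B.

Definition orthocomplement (K : set E) : set E :=
  [set x | forall k, K k -> '<<x, k>> = 0].

(* Internal direct sum E = K (+) K^orth. *)
Definition complemented (K : set E) : Prop :=
  (forall x, exists k p, [/\ K k, orthocomplement K p & x = k + p])
  /\ K `&` orthocomplement K = [set 0].

End ClosedIdeal.

(* A closed ideal is a submodule.  For [k] in the ideal and
   [a := '<<k, k>>], the Cesaro means [m] of the sequence [k (1 + z a)^j]
   ([z] imaginary) satisfy [k b - m b \in K], and the norm of [m] is
   arbitrarily small. *)
Section IdealSubmodule.
Context {R : realType} {B : cstarAlgType R}.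
Implicit Types (a b c : B).

Lemma norm_star a : `|star a| = `|a|.
Proof.
have H b : `|b| <= `|star b|.
  have [->|b0] := eqVneq `|b| 0; first exact: normr_ge0.
  have b1 : 0 < `|b| by rewrite lt_def b0 normr_ge0.
  by rewrite -(ler_pM2r b1) -expr2 -norm_starM norm_amul.
by apply/le_anti; rewrite H andbT -{2}(starK a) H.
Qed.

Lemma amulNl a b : - a ** b = - (a ** b).
Proof. by rewrite -scaleN1r amulZl scaleN1r. Qed.

Lemma amulNr a b : a ** - b = - (a ** b).
Proof. by rewrite -scaleN1r amulZr scaleN1r. Qed.

Lemma starN a : star (- a) = - star a.
Proof. by rewrite -scaleN1r starZ rmorphN1 scaleN1r. Qed.

Lemma amul0r a : a ** 0 = 0.
Proof. by apply: (addrI (a ** 0)); rewrite -amulDr !addr0. Qed.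

Lemma amul0l a : 0 ** a = 0.
Proof. by apply: (addrI (0 ** a)); rewrite -amulDl !addr0. Qed.

Lemma star0 : star 0 = 0 :> B.
Proof. by apply: (addrI (star 0)); rewrite -starD !addr0. Qed.

Lemma imaginary_step a b (z : R[i]) : star a = a -> z^* = - z ->
  `|b + z *: (a ** b)| ^+ 2 <= (1 + `|z| ^+ 2 * `|a| ^+ 2) * `|b| ^+ 2.
Proof.
move=> sa zz; rewrite -norm_starM.
have -> : star (b + z *: (a ** b)) ** (b + z *: (a ** b)) =
          star b ** b + (`|z| ^+ 2) *: (star (a ** b) ** (a ** b)).
  rewrite normCK zz starD starZ starM sa zz amulDr !amulDl !amulZr !amulZl !amulA.
  rewrite scaleNr -addrA; congr (_ + _); rewrite addrA addNr add0r.
  by rewrite scalerA.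
apply: (le_trans (ler_normD _ _)); rewrite normrZ !norm_starM normrX normr_id.
rewrite mulrDl mul1r lerD2l -mulrA ler_wpM2l ?exprn_ge0 ?normr_ge0 //.
by rewrite -exprMn lerXn2r ?nnegrE ?mulr_ge0 ?normr_ge0 ?norm_amul.
Qed.

Lemma bernoulli_bound (y : R[i]) n j : 0 <= y -> n%:R * y <= 4^-1 -> (j <= n)%N ->
  (1 + y) ^+ j <= 4.
Proof.
move=> y0 ny jn.
have bd i : (i <= n)%N -> i%:R * y <= 4^-1.
  by move=> ?; apply: le_trans ny; rewrite ler_wpM2r ?ler_nat.
have key : (1 + y) ^+ j * (1 - j%:R * y) <= 1.
  elim: j jn => [|j IH] jn; first by rewrite expr0 mul0r subr0 mulr1.
  apply: le_trans (IH (ltnW jn)); rewrite exprSr -mulrA.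
  rewrite ler_wpM2l ?exprn_ge0 ?addr_ge0 //.
  rewrite -subr_ge0 (_ : _ - _ = j.+1%:R * y ^+ 2); last first.
    by rewrite -(natr1 j); ring.
  by rewrite mulr_ge0 ?exprn_ge0.
have h : 4^-1 <= 1 - j%:R * y.
  rewrite lerBrDr; apply: (le_trans (lerD (lexx _) (bd _ jn))).
  by rewrite -mulr2n -(mulr_natr _ 2) ler_pdivrMl // mulr1 ler_nat.
rewrite -[leRHS]mul1r -ler_pdivrMr //; apply: le_trans key.
by rewrite ler_wpM2l ?exprn_ge0 ?addr_ge0.
Qed.

Lemma iter_bound a b (z : R[i]) n j : star a = a -> z^* = - z ->
  n%:R * (`|z| * `|a|) ^+ 2 <= 4^-1 -> (j <= n)%N ->
  `|iter j (fun c => c + z *: (a ** c)) b| <= 2 * `|b|.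
Proof.
move=> sa zz hn jn.
set f := fun c => _; set y := _ ^+ 2 in hn.
have y0 : 0 <= y by rewrite exprn_ge0 ?mulr_ge0.
have H : `|iter j f b| ^+ 2 <= (1 + y) ^+ j * `|b| ^+ 2.
  elim: j jn => [|j IH] jn; first by rewrite mul1r.
  rewrite iterS; apply: (le_trans (imaginary_step _ sa zz)).
  rewrite (exprS _ j) -mulrA -exprMn -/y ler_wpM2l ?addr_ge0 //; exact/IH/ltnW.
rewrite -ler_sqr ?nnegrE ?mulr_ge0 ?normr_ge0 //.
apply: (le_trans H); rewrite exprMn -natrX ler_wpM2r ?exprn_ge0 //.
exact: (bernoulli_bound y0 hn jn).
Qed.


Lemma archimedean_complex (x : R[i]) : 0 <= x -> exists n : nat, x < n%:R.
Proof.
move=> x0; exists (Num.bound (complex.Re x)).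
rewrite -(RRe_real (ger0_real x0)) -(rmorph_nat (real_complex R)) ltcR.
by apply: archi_boundP; rewrite -lecR RRe_real ?ger0_real.
Qed.

Lemma ractNl (V : rightModType B) (x : V) b : - x <.> b = - (x <.> b).
Proof. by rewrite -scaleN1r ractZl scaleN1r. Qed.

Lemma ract0l (V : rightModType B) b : 0 <.> b = 0 :> V.
Proof. by apply: (addrI (0 <.> b)); rewrite -ractDl !addr0. Qed.

Variable E : hilbertModType B.
Implicit Types (x y k : E).

Let innE := (let: And3 p _ _ := @innerP _ _ E in p).

Lemma norm_inner x : `|'<<x, x>>| = `|x| ^+ 2.
Proof. by have [_ -> _] := @innerP _ _ E; rewrite sqrtCK. Qed.

Lemma innerDr x y z : '<<x, y + z>> = '<<x, y>> + '<<x, z>> :> B.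
Proof. exact: ipDr innE x y z. Qed.

Lemma innerZr (c : R[i]) x y : '<<x, c *: y>> = c *: '<<x, y>> :> B.
Proof. exact: ipZr innE c x y. Qed.

Lemma inner_ract x y b : '<<x, y <.> b>> = '<<x, y>> ** b.
Proof. exact: ip_ract innE x y b. Qed.

Lemma inner_star x y : star '<<x, y>> = '<<y, x>>.
Proof. exact: ip_star innE x y. Qed.

Lemma innerDl x y z : '<<x + y, z>> = '<<x, z>> + '<<y, z>> :> B.
Proof. by rewrite -inner_star innerDr starD !inner_star. Qed.

Lemma innerZl (c : R[i]) x y : '<<c *: x, y>> = c^* *: '<<x, y>> :> B.
Proof. by rewrite -inner_star innerZr starZ inner_star. Qed.

Lemma inner_ractl x y b : '<<x <.> b, y>> = star b ** '<<x, y>>.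
Proof. by rewrite -inner_star inner_ract starM inner_star. Qed.

Lemma inner0r x : '<<x, 0>> = 0 :> B.
Proof. by apply: (addrI '<<x, 0>>); rewrite -innerDr !addr0. Qed.

Lemma inner0l x : '<<0, x>> = 0 :> B.
Proof. by rewrite -inner_star inner0r star0. Qed.

Lemma norm_ract x b : `|x <.> b| <= `|x| * `|b|.
Proof.
rewrite -ler_sqr ?nnegrE ?mulr_ge0 // -norm_inner inner_ract inner_ractl.
apply: (le_trans (norm_amul _ _)); rewrite exprMn (expr2 `|b|) mulrA.
rewrite ler_wpM2r // mulrC -norm_star -norm_inner; exact: norm_amul.
Qed.

Section Mean.
Variables (k : E) (z : R[i]) (N : nat).
Hypotheses (zz : z^* = - z) (N0 : (0 < N)%N).
Let a := '<<k, k>>.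
Hypothesis zN : N%:R * (`|z| * `|a|) ^+ 2 <= 4^-1.
Let u j := iter j (fun x : E => x + z *: (x <.> a)) k.
Let m := N%:R^-1 *: \sum_(j < N) u j.

Let N0' : N%:R != 0 :> R[i]. Proof. by rewrite pnatr_eq0 -lt0n. Qed.

Let mean_norm (V : normedModType R[i]) (F : nat -> V) (c : R[i]) :
  (forall j, (j < N)%N -> `|F j| <= c) -> `|N%:R^-1 *: \sum_(j < N) F j| <= c.
Proof.
move=> Fc; rewrite normrZ ger0_norm ?invr_ge0 // ler_pdivrMl ?ltr0n //.
apply: (le_trans (ler_norm_sum _ _ _)).
rewrite mulr_natl -[X in _ *+ X]card_ord -sumr_const.
by apply: ler_sum => j _; exact: Fc.
Qed.

Lemma mean_ideal (K : closedIdeal E) b :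
  ideal_set K k -> ideal_set K ((k - m) <.> b).
Proof.
move=> Kk.
have KN x : ideal_set K x -> ideal_set K (- x).
  by rewrite -scaleN1r => /(idealZ (-1)).
have step j : ideal_set K ((u j - k) <.> b).
  elim: j => [|j IH]; first by rewrite subrr ract0l; exact: ideal0.
  rewrite /u iterS -/(u j) addrAC ractDl; apply: idealD => //.
  rewrite ractZl -ractA -inner_ract; apply: idealZ; exact: ideal_inner.
have -> : k - m = - (N%:R^-1 *: \sum_(j < N) (u j - k)).
  rewrite sumrB sumr_const card_ord scalerBr opprB -[k *+ N]scaler_nat scalerA.
  by rewrite mulVf // scale1r.
rewrite ractNl ractZl; apply/KN/idealZ.
elim/big_ind: _ => [|x y Kx Ky|j _ //]; first by rewrite ract0l; exact: ideal0.
by rewrite ractDl; exact: idealD.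
Qed.

Let f c := c + (- z) *: (a ** c).

Let inner_u j x : '<<u j, x>> = iter j f '<<k, x>>.
Proof.
elim: j => [//|j IH].
by rewrite /u !iterS -/(u j) /f -IH innerDl innerZl zz inner_ractl inner_star.
Qed.

Let norm_inner_u j x : (j <= N)%N -> `|'<<u j, x>>| <= 2 * `|'<<k, x>>|.
Proof.
move=> jN; rewrite inner_u; apply: (@iter_bound _ _ _ N) => //.
- exact: inner_star.
- by rewrite rmorphN /= zz.
- by rewrite normrN.
Qed.

Let inner_ml x : '<<m, x>> = N%:R^-1 *: \sum_(j < N) '<<u j, x>>.
Proof.
rewrite innerZl rmorphV ?unitfE // rmorph_nat; congr (_ *: _).
by apply: (big_morph (fun y => '<<y, x>>)) => [y y'|]; rewrite ?innerDl ?inner0l.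
Qed.

Let inner_mr x : '<<x, m>> = N%:R^-1 *: \sum_(j < N) '<<x, u j>>.
Proof.
rewrite innerZr; congr (_ *: _).
by apply: (big_morph (fun y => '<<x, y>>)) => [y y'|]; rewrite ?innerDr ?inner0r.
Qed.

Let h := '<<k, m>>.

Lemma mean_norm1 : `|m| ^+ 2 <= 2 * `|h|.
Proof.
rewrite -norm_inner inner_ml; apply: (mean_norm (F := fun j => '<<u j, m>>)).
by move=> j jN; apply: norm_inner_u; exact: ltnW.
Qed.

Lemma mean_norm2 : `|h| ^+ 2 <= 2 * `|a ** h|.
Proof.
rewrite -norm_starM inner_star -inner_ract inner_ml.
apply: (mean_norm (F := fun j => '<<u j, k <.> h>>)) => j jN.
by rewrite (le_trans (norm_inner_u _ (ltnW jN))) // inner_ract.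
Qed.

Lemma mean_norm3 : N%:R * (`|z| * `|a ** h|) <= 3 * `|a|.
Proof.
have comm j : a ** '<<k, u j>> = '<<k, u j>> ** a.
  elim: j => [//|j IH]; rewrite /u iterS -/(u j) innerDr innerZr inner_ract.
  by rewrite amulDr amulDl amulZr amulZl amulA IH.
have -> : N%:R * (`|z| * `|a ** h|) = `|'<<k, u N>> - a|.
  rewrite -normrZ -[X in X * _]ger0_norm // -normrZ; congr `|_|.
  rewrite /h inner_mr amulZr !scalerA mulrAC divff // mul1r.
  rewrite (big_morph (amul a) (amulDr a) (amul0r a)) scaler_sumr.
  under eq_bigr => j _ do rewrite comm.
  rewrite -[a]/('<<k, u 0>>) -(telescope_sumr (fun j => '<<k, u j>>)) // big_mkord.
  apply: eq_bigr => j _; rewrite /u iterS -/(u j) innerDr innerZr inner_ract.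
  by rewrite addrAC subrr add0r.
apply: (le_trans (ler_normB _ _)).
rewrite -[3]/(2 + 1)%:R natrD mulrDl mul1r lerD2r -inner_star norm_star.
exact: norm_inner_u.
Qed.

Lemma mean_bound : N%:R * `|z| * `|m| ^+ 4 <= 24 * `|a|.
Proof.
have -> : 24 * `|a| = 8 * (3 * `|a|) by rewrite mulrA -natrM.
apply: le_trans (ler_wpM2l _ mean_norm3) => //.
rewrite -[leRHS]mulrCA -[X in X <= _]mulrA ler_wpM2l //.
rewrite [leRHS]mulrCA ler_wpM2l //.
rewrite (exprM _ 2 2) (@le_trans _ _ ((2 * `|h|) ^+ 2)) //.
  by rewrite lerXn2r ?nnegrE ?mulr_ge0 ?exprn_ge0 // mean_norm1.
rewrite exprMn -natrX -[8]/(2 ^ 2 * 2)%:R natrM -(mulrA _ 2) ler_wpM2l //.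
exact: mean_norm2.
Qed.

End Mean.

Lemma ideal_ract (K : closedIdeal E) k b :
  ideal_set K k -> ideal_set K (k <.> b).
Proof.
move=> Kk; apply: (@ideal_closed _ _ _ K) => U /nbhs_ballP[e /= e0 eU].
set a := '<<k, k>>.
pose t : R[i] := (2 * (`|a| + 1))^-1.
have a1 : 0 < `|a| + 1 by rewrite ltr_wpDl.
have t0 : 0 < t by rewrite invr_gt0 mulr_gt0.
pose b1 := `|b| + 1.
have b10 : 0 < b1 by rewrite ltr_wpDl.
pose A := 24 * `|a| * b1 ^+ 4 / (t * e ^+ 4).
have A0 : 0 <= A by rewrite !(mulr_ge0, invr_ge0, exprn_ge0) // ltW.
have [n An] := archimedean_complex A0.
have n0 : 0 < n%:R :> R[i] by apply: le_lt_trans An.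
pose z : R[i] := 'i%R * (t / n%:R).
have nz : `|z| = t / n%:R.
  by rewrite normrM normCi mul1r ger0_norm // mulr_ge0 ?invr_ge0 // ltW.
have zz : z^* = - z.
  by rewrite rmorphM /= conjCi mulNr conj_Creal // ger0_real // -nz.
have nN : (0 < n ^ 2)%N by rewrite expn_gt0 -(ltr0n R[i]) n0.
have zN : (n ^ 2)%:R * (`|z| * `|a|) ^+ 2 <= 4^-1.
  rewrite natrX -exprMn nz (_ : n%:R * _ = t * `|a|); last first.
    by rewrite mulrA (mulrC t) mulVKf ?lt0r_neq0.
  rewrite (_ : 4^-1 = 2^-1 ^+ 2); last by rewrite exprVn -natrX.
  rewrite lerXn2r ?nnegrE ?mulr_ge0 ?invr_ge0 ?(ltW t0) //.
  by rewrite /t invfM -mulrA ler_piMr ?invr_ge0 // ler_pdivrMl // mulr1 lerDl.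
have := mean_bound zz nN zN; have := mean_ideal z nN b Kk.
rewrite -/a; set m := _ *: _ => Km mb.
exists ((k - m) <.> b); split=> //; apply: eU.
rewrite -ball_normE /= ractDl opprD addrA subrr add0r ractNl opprK.
apply: (le_lt_trans (norm_ract _ _)).
apply: (@le_lt_trans _ _ (`|m| * b1)); first by rewrite ler_wpM2l // lerDl.
rewrite -(@ltr_pXn2r _ 4) ?nnegrE ?mulr_ge0 ?(ltW e0) ?(ltW b10) //.
move: An; rewrite /A ltr_pdivrMr ?mulr_gt0 ?exprn_gt0 // => An.
have nt : 0 < n%:R * t by rewrite mulr_gt0.
rewrite -(ltr_pM2l nt) -[X in _ < X]mulrA; apply: le_lt_trans An.
rewrite exprMn mulrA ler_wpM2r ?exprn_ge0 ?(ltW b10) //.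
apply: le_trans mb; rewrite nz natrX ler_wpM2r ?exprn_ge0 //.
rewrite (_ : n%:R ^+ 2 * _ = n%:R * t) //.
by rewrite expr2 -mulrA (mulrC t) mulVKf ?lt0r_neq0.
Qed.

End IdealSubmodule.

Section Quotient.
Context {R : realType} {B : cstarAlgType R} {E : hilbertModType B}.
Variable K : closedIdeal E.
Local Open Scope quotient_scope.

Definition ideal_pred : {pred E} := fun x => `[< ideal_set K x >].

Lemma ideal_submod_closed : submod_closed ideal_pred.
Proof.
split=> [|z x y]; first by apply/asboolP; exact: ideal0.
by move=> /asboolP Kx /asboolP Ky; apply/asboolP/idealD => //; exact: idealZ.
Qed.

HB.instance Definition _ :=
  GRing.isSubmodClosed.Build R[i] E ideal_pred ideal_submod_closed.

(* The quotient E / K; the class of [x] is [\pi x]. *)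
Definition quotient_module : Type := Quotient.quot ideal_pred.

HB.instance Definition _ := Choice.on quotient_module.
HB.instance Definition _ := GRing.Zmodule.on quotient_module.
HB.instance Definition _ := EqQuotient.on quotient_module.

Local Notation Q := quotient_module.
Implicit Types (x y : E) (p q : Q).

Lemma eq_quotient x y : \pi_Q x = \pi_Q y <-> ideal_set K (x - y).
Proof.
split=> [/eqP|xy]; last apply/eqP.
  by rewrite -Quotient.idealrBE => /asboolP.
by rewrite -Quotient.idealrBE; apply/asboolP.
Qed.

Lemma quotientD x y : \pi_Q (x + y) = \pi_Q x + \pi_Q y.
Proof. exact: (raddfD (\pi_(Quotient.quot ideal_pred))). Qed.

Lemma quotient0 : \pi_Q 0 = 0.
Proof. exact: (raddf0 (\pi_(Quotient.quot ideal_pred))). Qed.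

(* The operations are defined on representatives; they do not depend on the
   choice by [quotientZ] and [quotient_ract]. *)
Definition quot_scale (z : R[i]) q : Q := \pi_Q (z *: repr q).

Definition quot_ract q (b : B) : Q := \pi_Q (repr q <.> b).

Lemma pi_quot_scale z x : quot_scale z (\pi_Q x) = \pi_Q (z *: x).
Proof.
apply/eq_quotient; rewrite -scalerBr; apply: idealZ.
by apply/eq_quotient; rewrite reprK.
Qed.

Lemma pi_quot_ract b x : quot_ract (\pi_Q x) b = \pi_Q (x <.> b).
Proof.
apply/eq_quotient; rewrite -ractNl -ractDl; apply: ideal_ract.
by apply/eq_quotient; rewrite reprK.
Qed.

Lemma quot_scaleA z w q : quot_scale z (quot_scale w q) = quot_scale (z * w) q.
Proof.
rewrite -[q]reprK (pi_quot_scale w) (pi_quot_scale z) (pi_quot_scale (z * w)).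
by rewrite scalerA.
Qed.

Lemma quot_scale1 : left_id 1 quot_scale.
Proof. by move=> q; rewrite -[q]reprK pi_quot_scale scale1r. Qed.

Lemma quot_scaleDr : right_distributive quot_scale +%R.
Proof.
move=> z p q; rewrite -[p]reprK -[q]reprK -quotientD !pi_quot_scale.
by rewrite scalerDr quotientD.
Qed.

Lemma quot_scaleDl q : {morph quot_scale^~ q : z w / z + w}.
Proof. by move=> z w; rewrite -[q]reprK !pi_quot_scale scalerDl quotientD. Qed.

HB.instance Definition _ := GRing.Zmodule_isLmodule.Build R[i] Q
  quot_scaleA quot_scale1 quot_scaleDr quot_scaleDl.

Lemma quotientZ (z : R[i]) x : \pi_Q (z *: x) = z *: \pi_Q x.
Proof. exact: esym (pi_quot_scale z x). Qed.

Let nrm x : R := complex.Re `|x|.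

Let nrmE x : (nrm x)%:C = `|x|.
Proof. by rewrite RRe_real // normr_real. Qed.

Let nrm_ge0 x : 0 <= nrm x.
Proof. by rewrite -lecR nrmE rmorph0. Qed.

(* The infimum of the norm over the coset; see [quotient_normE] below. *)
Definition quot_norm q : R[i] :=
  (inf [set nrm x | x in [set x | \pi_Q x = q]])%:C.

Let N q : R := inf [set nrm x | x in [set x | \pi_Q x = q]].

Let has_infN q : has_inf [set nrm x | x in [set x | \pi_Q x = q]].
Proof.
split; first by exists (nrm (repr q)), (repr q); rewrite //= reprK.
by exists 0 => _ [x _ <-].
Qed.

Let N_le q x : \pi_Q x = q -> N q <= nrm x.
Proof. by move=> xq; apply: ge_inf; [exact: (has_infN q).2|exists x]. Qed.

Let le_N q r : (forall x, \pi_Q x = q -> r <= nrm x) -> r <= N q.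
Proof.
by move=> H; apply: lb_le_inf; [exact: (has_infN q).1|move=> _ [x xq <-]; exact: H].
Qed.

Let N_adherent q (e : R) : 0 < e -> exists2 x, \pi_Q x = q & nrm x < N q + e.
Proof. by move=> /inf_adherent /(_ (has_infN q))[_ [x xq <-]]; exists x. Qed.

Lemma quot_normE x :
  quot_norm (\pi_Q x) = (inf [set complex.Re `|x + k| | k in ideal_set K])%:C.
Proof.
rewrite /quot_norm; congr (inf _)%:C; apply/seteqP; split=> [_ [y /= yx <-]|].
  exists (y - x); last by rewrite addrC subrK.
  by apply/eq_quotient.
move=> _ [k /= Kk <-]; exists (x + k) => //=.
by apply/eq_quotient; rewrite addrAC subrr add0r.
Qed.

Lemma quot_normD p q : quot_norm (p + q) <= quot_norm p + quot_norm q.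
Proof.
rewrite /quot_norm -rmorphD lecR; apply/ler_addgt0Pr => e e0.
have e2 : 0 < e / 2 by rewrite divr_gt0.
have [x xp xe] := N_adherent p e2; have [y yq ye] := N_adherent q e2.
apply: (le_trans (N_le (x := x + y) _)); first by rewrite quotientD xp yq.
apply: (@le_trans _ _ (nrm x + nrm y)).
  by rewrite -lecR rmorphD /= !nrmE ler_normD.
by rewrite [e]splitr addrACA; apply/ltW/ltrD.
Qed.

Let nrmZ (z : R[i]) x : nrm (z *: x) = complex.Re `|z| * nrm x.
Proof.
have zR : (complex.Re `|z|)%:C = `|z| by rewrite RRe_real // normr_real.
apply: (fmorph_inj (real_complex R)); rewrite rmorphM.
by rewrite [LHS]nrmE [X in _ * X]nrmE [X in X * _]zR normrZ.
Qed.

Let N0 : N 0 = 0.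
Proof.
apply/le_anti/andP; split; last by apply: le_N => x _.
by apply: le_trans (N_le quotient0) _; rewrite /nrm normr0.
Qed.

Let N_Z (z : R[i]) q : z != 0 -> complex.Re `|z| * N q <= N (z *: q).
Proof.
move=> z0; apply: le_N => y yq.
have c0 : 0 <= complex.Re `|z| by rewrite -lecR RRe_real ?normr_real // rmorph0.
rewrite -[y](scalerKV z0) nrmZ ler_wpM2l //.
by apply: N_le; rewrite quotientZ yq scalerK.
Qed.

Lemma quot_normZ (z : R[i]) q : quot_norm (z *: q) = `|z| * quot_norm q.
Proof.
have [->|z0] := eqVneq z 0.
  by rewrite scale0r normr0 mul0r /quot_norm -/(N 0) N0.
have zR : `|z| = (complex.Re `|z|)%:C by rewrite RRe_real // normr_real.
rewrite zR /quot_norm -rmorphM; congr (_%:C); rewrite -/(N _) -/(N _).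
apply/le_anti; rewrite N_Z // andbT -ler_pdivrMl; last first.
  by rewrite -ltcR -zR rmorph0 normr_gt0.
have := @N_Z z^-1 (z *: q); rewrite invr_eq0 scalerK // => /(_ z0).
suff -> : complex.Re `|z^-1| = (complex.Re `|z|)^-1 by [].
apply: (fmorph_inj (real_complex R)); rewrite fmorphV.
transitivity `|z^-1|; first by apply: RRe_real; exact: normr_real.
by rewrite normfV; exact: congr1 zR.
Qed.

Lemma quot_norm0_eq0 q : quot_norm q = 0 -> q = 0.
Proof.
move=> /(fmorph_inj (real_complex R)); rewrite -/(N q) => q0.
rewrite -[q]reprK -quotient0; apply/eq_quotient; rewrite subr0.
apply: (@ideal_closed _ _ _ K) => U /nbhs_ballP[e /= e0 eU].
have eR : e = (complex.Re e)%:C by rewrite RRe_real // gtr0_real.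
have [|x xq] := @N_adherent q (complex.Re e); first by rewrite -ltcR -eR rmorph0.
rewrite q0 add0r -ltcR nrmE -eR => xe.
exists (repr q - x); split; first by apply/eq_quotient; rewrite reprK.
by apply: eU; rewrite -ball_normE /= opprB addrC subrK.
Qed.

HB.instance Definition _ := Lmodule_isNormed.Build R[i] Q
  quot_normD quot_normZ quot_norm0_eq0.

Lemma quot_ractDl p q b : quot_ract (p + q) b = quot_ract p b + quot_ract q b.
Proof.
rewrite -[p]reprK -[q]reprK -quotientD !pi_quot_ract.
by rewrite ractDl quotientD.
Qed.

Lemma quot_ractDr q b c : quot_ract q (b + c) = quot_ract q b + quot_ract q c.
Proof. by rewrite -[q]reprK !pi_quot_ract ractDr quotientD. Qed.

Lemma quot_ractZl (z : R[i]) q b : quot_ract (z *: q) b = z *: quot_ract q b.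
Proof.
by rewrite -[q]reprK -quotientZ !pi_quot_ract -quotientZ ractZl.
Qed.

Lemma quot_ractZr (z : R[i]) q b : quot_ract q (z *: b) = z *: quot_ract q b.
Proof. by rewrite -[q]reprK !pi_quot_ract -quotientZ ractZr. Qed.

Lemma quot_ractA q b c : quot_ract q (b ** c) = quot_ract (quot_ract q b) c.
Proof.
rewrite -[q]reprK (pi_quot_ract b) (pi_quot_ract c) (pi_quot_ract (b ** c)).
by rewrite ractA.
Qed.

HB.instance Definition _ := isRightModule.Build R B Q
  quot_ractDl quot_ractDr quot_ractZl quot_ractZr quot_ractA.

Lemma quotient_ract x b : \pi_Q (x <.> b) = \pi_Q x <.> b.
Proof. exact: esym (pi_quot_ract b x). Qed.

Lemma quotient_normE x :
  `|\pi_Q x| = (inf [set complex.Re `|x + k| | k in ideal_set K])%:C.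
Proof. exact: quot_normE. Qed.

End Quotient.

(* Main.v *)
(* If E = K (+) K^orth, then E/K is isometric to K^orth, which inherits the inner
   product of E.  Conversely, let E/K be Hilbert for [ip] and q = x + K,
   a = ip q q.  As q <k, y> = 0 for k in K, the element a kills <K, E>, hence also
   <E, K>, so that y a lies in K^orth for every y in E.  Since q is a limit of
   combinations of elements (y + K) a, the image of K^orth in E/K is dense.  The
   quotient map is isometric on K^orth, so this image is closed, and K + K^orth = E. *)
Require Import Defs.
From HB Require Import structures.
From mathcomp Require Import all_boot all_order all_algebra.
From mathcomp Require Import complex.
From mathcomp Require Import all_classical all_reals all_analysis.

Section Orthocomplement.
Set Implicit Arguments.
Unset Strict Implicit.
Import Order.TTheory GRing.Theory Num.Theory.
Import numFieldNormedType.Exports.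
Local Open Scope classical_set_scope.
Local Open Scope quotient_scope.
Local Open Scope ring_scope.
Local Open Scope cstar_scope.
Context {R : realType} {B : cstarAlgType R}.

(** * Definiteness, completeness and a density criterion *)

Lemma starM_eq0 (a : B) : star a ** a = 0 -> a = 0.
Proof.
move=> a0; apply/eqP; rewrite -normr_eq0 -sqrf_eq0; apply/eqP.
by rewrite -norm_starM a0 normr0.
Qed.

Lemma inner_eq0 (E : hilbertModType B) (x : E) : '<<x, x>> = 0 :> B -> x = 0.
Proof.
move=> x0; apply/eqP; rewrite -normr_eq0 -sqrf_eq0; apply/eqP.
by rewrite -norm_inner x0 normr0.
Qed.

Lemma hilbert_complete {E : hilbertModType B} {F : set_system E} :
  ProperFilter F -> cauchy F -> cvg F.
Proof. by have [_ _] := @innerP _ _ E; apply. Qed.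

(* Cesaro means [m] of [q (1 + z a)^j], [a := '<<q, q>>], are small by
   [mean_bound], whereas [q - m] is a combination of elements [y a]. *)
Lemma closure_ract_inner (V : hilbertModType B) (L : set V) (q : V) :
  L 0 -> (forall x y, L x -> L y -> L (x + y)) ->
  (forall (z : R[i]) x, L x -> L (z *: x)) ->
  (forall y, L (y <.> '<<q, q>>)) -> closure L q.
Proof.
move=> L0 LD LZ Lq U /nbhs_ballP[e /= e0 eU].
set a := '<<q, q>> : B.
(* The choice of [t] gives t|a| <= 1/2. With |z| = t/n and n^2 steps, n^2 (|z||a|)^2 = (t|a|)^2 <=
   1/4, as [mean_bound] demands; its conclusion n t |m|^4 <= 24|a| yields |m| < e once n > [A]. *)
pose t : R[i] := (2 * (`|a| + 1))^-1.
have a1 : 0 < `|a| + 1 by rewrite ltr_wpDl.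
have t0 : 0 < t by rewrite invr_gt0 mulr_gt0.
pose A := 24 * `|a| / (t * e ^+ 4).
have A0 : 0 <= A by rewrite !(mulr_ge0, invr_ge0, exprn_ge0) // ltW.
have [n An] := archimedean_complex A0.
have n0 : 0 < n%:R :> R[i] by apply: le_lt_trans An.
pose z : R[i] := 'i%R * (t / n%:R).
have nz : `|z| = t / n%:R.
  by rewrite normrM normCi mul1r ger0_norm // mulr_ge0 ?invr_ge0 // ltW.
have zz : Num.conj z = - z.
  by rewrite rmorphM /= conjCi mulNr conj_Creal // ger0_real // -nz.
have nN : (0 < n ^ 2)%N by rewrite expn_gt0 -(ltr0n R[i]) n0.
have zN : (n ^ 2)%:R * (`|z| * `|a|) ^+ 2 <= 4^-1.
  rewrite natrX -exprMn nz (_ : n%:R * _ = t * `|a|); last first.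
    by rewrite mulrA (mulrC t) mulVKf ?lt0r_neq0.
  rewrite (_ : 4^-1 = 2^-1 ^+ 2); last by rewrite exprVn -natrX.
  rewrite lerXn2r ?nnegrE ?mulr_ge0 ?invr_ge0 ?(ltW t0) //.
  by rewrite /t invfM -mulrA ler_piMr ?invr_ge0 // ler_pdivrMl // mulr1 lerDl.
have := mean_bound zz nN zN; rewrite -/a.
set m := _ *: _ => mb.
pose u j := iter j (fun y : V => y + z *: (y <.> a)) q.
have Lu j : L (u j - q).
  elim: j => [|j IH]; first by rewrite subrr.
  by rewrite /u iterS -/(u j) addrAC; apply: LD => //; apply/LZ/Lq.
have Lm : L (q - m).
  have -> : q - m = (- (n ^ 2)%:R^-1) *: \sum_(j < n ^ 2) (u j - q).
    rewrite sumrB sumr_const card_ord scaleNr scalerBr opprB.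
    by rewrite -[q *+ _]scaler_nat scalerA mulVf ?scale1r // pnatr_eq0 -lt0n.
  by apply: LZ; elim/big_ind: _ => // *; exact: LD.
exists (q - m); split=> //; apply: eU.
rewrite -ball_normE /= opprD addrA subrr add0r opprK.
rewrite -(@ltr_pXn2r _ 4) ?nnegrE ?(ltW e0) //.
move: An; rewrite /A ltr_pdivrMr ?mulr_gt0 ?exprn_gt0 // => An.
have nt : 0 < n%:R * t by rewrite mulr_gt0.
rewrite -(ltr_pM2l nt) -[X in _ < X]mulrA; apply: le_lt_trans An.
apply: le_trans mb; rewrite nz natrX.
suff -> : n%:R ^+ 2 * (t / n%:R) = n%:R * t by [].
by rewrite expr2 -mulrA (mulrC t) mulVKf ?lt0r_neq0.
Qed.

Context {E : hilbertModType B}.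
Variable K : closedIdeal E.
Implicit Types x y k p : E.
Local Notation Q := (quotient_module K).
Local Notation Kp := (orthocomplement K).

(** * The orthogonal complement of K *)

Lemma ideal_ortho_eq0 {x} : ideal_set K x -> Kp x -> x = 0.
Proof. by move=> Kx /(_ _ Kx)/inner_eq0. Qed.

Lemma ortho0 : Kp 0.
Proof. by move=> k _; rewrite inner0l. Qed.

Lemma orthoD x y : Kp x -> Kp y -> Kp (x + y).
Proof. by move=> Kx Ky k Kk; rewrite innerDl Kx // Ky // addr0. Qed.

Lemma orthoZ (z : R[i]) x : Kp x -> Kp (z *: x).
Proof. by move=> Kx k Kk; rewrite innerZl Kx // scaler0. Qed.

Lemma ortho_ract x b : Kp x -> Kp (x <.> b).
Proof. by move=> Kx k Kk; rewrite inner_ractl Kx // amul0r. Qed.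

Lemma orthoB x y : Kp x -> Kp y -> Kp (x - y).
Proof. by move=> Kx Ky; rewrite -scaleN1r; apply: orthoD => //; apply: orthoZ. Qed.

(** The product lies both in K and in the submodule K^orth. *)
Lemma ortho_ract_inner x k y :
  Kp x -> ideal_set K k -> x <.> '<<k, y>> = 0.
Proof.
by move=> Kx Kk; apply: ideal_ortho_eq0; [exact: ideal_inner|exact: ortho_ract].
Qed.

(* The ideal property puts [k '<<k, x>>] in K, but not directly [k '<<x, k>>]:
   this identity is what allows to exchange the two. *)
Lemma inner_ideal_sq x k :
  '<<k <.> '<<k, x>>, x>> = '<<x, k>> ** star '<<x, k>> :> B.
Proof. by rewrite inner_ractl !inner_star. Qed.

(* The right-hand side is visibly closed in [x]. *)
Lemma orthoP x :
  Kp x <-> forall k y, ideal_set K k -> x <.> '<<k, y>> = 0.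
Proof.
split=> [Kx k y|Kx k Kk]; first exact: ortho_ract_inner.
set c : B := '<<x, k>>.
(* The hypothesis for the element [k <.> '<<k, x>>] of K gives [x <.> (c ** star c) = 0]. Pairing
   with [k] and multiplying by [c] shows that the self-adjoint [star c ** c] has square 0. *)
apply: starM_eq0; apply: starM_eq0; rewrite starM starK.
have : x <.> (c ** star c) = 0.
  rewrite -inner_ideal_sq; apply: Kx; exact: ideal_inner.
move/(congr1 (fun y => '<<k, y>> : B)); rewrite inner0r inner_ract.
by rewrite -inner_star -/c amulA => /(congr1 (amul^~ c)); rewrite amul0l -!amulA.
Qed.

(** With a = <p, p>, the cross terms of <p + k, p + k> vanish and a <k, k> = <p, p <k, k>> = 0. So
    a^2 = a <p + k, p + k>, and |a| cancels after taking norms. *)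
Lemma ortho_norm_le p k : Kp p -> ideal_set K k -> `|p| <= `|p + k|.
Proof.
move=> Kpp Kk; rewrite -ler_sqr ?nnegrE // -!norm_inner.
set a : B := '<<p, p>>.
have [->|a0] := eqVneq a 0; first by rewrite normr0.
rewrite -(ler_pM2l (x := `|a|)) ?normr_gt0 // -expr2 -norm_starM inner_star -/a.
suff -> : a ** a = a ** '<<p + k, p + k>> by exact: norm_amul.
have kp : '<<k, p>> = 0 :> B by rewrite -inner_star Kpp // star0.
rewrite innerDl !innerDr (Kpp k) // kp addr0 add0r amulDr.
by rewrite -[X in _ + X]inner_ract ortho_ract_inner // inner0r addr0.
Qed.

(** * The quotient norm on K^orth and closedness of its image *)

Lemma has_lbound_coset_norm x :
  has_lbound [set complex.Re `|x + k| | k in ideal_set K].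
Proof.
exists 0 => _ [k _ <-].
by rewrite -lecR RRe_real ?normr_real // rmorph0.
Qed.

Lemma quotient_norm_le x : `|\pi_Q x| <= `|x|.
Proof.
rewrite quotient_normE -[leRHS]RRe_real ?normr_real // lecR.
apply: ge_inf; first exact: has_lbound_coset_norm.
by exists 0; [exact: ideal0|rewrite addr0].
Qed.

Lemma ortho_quotient_norm p : Kp p -> `|\pi_Q p| = `|p|.
Proof.
move=> Kpp; apply/le_anti; rewrite quotient_norm_le /=.
rewrite quotient_normE -[leLHS]RRe_real ?normr_real // lecR.
apply: lb_le_inf; first by exists (complex.Re `|p + 0|), 0 => //; exact: ideal0.
move=> _ [k Kk <-]; rewrite -lecR !RRe_real ?normr_real //.
exact: ortho_norm_le.
Qed.

Lemma quotientB x y : \pi_Q (x - y) = \pi_Q x - \pi_Q y.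
Proof. exact: (raddfB (\pi_(Quotient.quot (ideal_pred K)))). Qed.

Lemma closed_ortho_quotient : closed [set \pi_Q p | p in Kp].
Proof.
move=> q clq.
(* The sets [A e] generate a filter on K^orth whose classes tend to [q]; isometry on K^orth makes it
   Cauchy in E. *)
pose A (e : R[i]) := [set p | Kp p /\ `|\pi_Q p - q| < e].
pose F : set_system E :=
  filter_from [set e : R[i] | 0 < e] A.
have FP : ProperFilter F.
  apply: filter_from_proper; last first.
    move=> e /= e0; have [_ [[p Kpp <-]]] := clq _ (nbhsx_ballx q e e0).
    by rewrite -ball_normE /= distrC => ?; exists p.
  apply: filter_from_filter; first by exists 1; rewrite /= ltr01.
  move=> d e /= d0 e0.
  (* The order of R[i] is partial, but positive radii are real, hence comparable. *)
  have de : (d >=< e)%R by rewrite real_comparable ?gtr0_real.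
  exists (Order.min d e); first by rewrite comparable_lt_min // d0.
  by move=> p /= [Kpp]; rewrite comparable_lt_min // => /andP[? ?]; split.
have Fc : cauchy F.
  apply: cauchy_exP => e e0; have e2 : 0 < e / 2 by rewrite divr_gt0.
  have Fe : F (A (e / 2)) by exists (e / 2).
  have [p [Kpp pq]] := filter_ex Fe.
  exists p; exists (e / 2) => // p' /= [Kp' p'q].
  rewrite -ball_normE /= -ortho_quotient_norm; last exact: orthoB.
  rewrite quotientB (le_lt_trans (ler_distD q _ _)) // [e]splitr ltrD //.
  by rewrite distrC.
have Fx := hilbert_complete FP Fc; set x := lim F in Fx.
have approx e : 0 < e -> exists p, [/\ Kp p, `|\pi_Q p - q| < e & `|x - p| < e].
  move=> e0; have Fe : F (ball x e) by apply: Fx; exact: nbhsx_ballx.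
  have Fe' : F (A e) by exists e.
  have [p [[Kpp pq]]] := filter_ex (filterI Fe' Fe).
  by rewrite -ball_normE /=; exists p.
exists x.
  (* The equations of [orthoP] pass to the limit: x b = (x - p) b for p in K^orth close to x.
     Dividing by |b| + 1 covers b = 0. *)
  apply/orthoP => k y Kk; apply/eqP; rewrite -normr_le0.
  apply/ler_addgt0Pr => e e0.
  set b : B := '<<k, y>>.
  have b1 : 0 < `|b| + 1 by rewrite ltr_wpDl.
  have [p [Kpp _ xp]] := approx _ (divr_gt0 e0 b1).
  have -> : x <.> b = (x - p) <.> b.
    by rewrite ractDl ractNl (ortho_ract_inner y Kpp Kk) subr0.
  rewrite add0r (le_trans (norm_ract _ _)) //.
  apply: (@le_trans _ _ (`|x - p| * (`|b| + 1))).
    by rewrite ler_wpM2l // lerDl.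
  by rewrite -ler_pdivlMr // ltW.
apply/eqP; rewrite -subr_eq0 -normr_le0; apply/ler_addgt0Pr => e e0.
have e2 : 0 < e / 2 by rewrite divr_gt0.
have [p [Kpp pq xp]] := approx _ e2.
rewrite add0r (le_trans (ler_distD (\pi_Q p) _ _)) // [e]splitr lerD ?(ltW pq) //.
by rewrite -quotientB (le_trans (quotient_norm_le _)) // ltW.
Qed.

(** * From a Hilbert structure on E/K to a complement *)

(** Lets [closure_ract_inner] be applied to E/K itself. *)
Definition hilbert_quotient (ip : Q -> Q -> B) (H : hilbert_product ip) :
  hilbertModType B := HB.pack Q (isHilbertModule.Build R B Q H).

Lemma complemented_of_hilbert (ip : Q -> Q -> B) :
  hilbert_product ip -> complemented K.
Proof.
move=> H; have [ipH _ _] := H.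
pose V := hilbert_quotient H.
split; last first.
  apply/seteqP; split=> [x [Kx Kpx]|_ ->]; first exact: (ideal_ortho_eq0 Kx Kpx).
  by split; [exact: ideal0|exact: ortho0].
move=> x; suff [p Kpp px] : [set \pi_Q p | p in Kp] (\pi_Q x).
  exists (x - p), p; split=> //; last by rewrite subrK.
  by apply/eq_quotient.
apply: closed_ortho_quotient.
apply: (@closure_ract_inner V).
- by exists 0; [exact: ortho0|exact: quotient0].
- move=> _ _ [p Kpp <-] [p' Kpp' <-]; exists (p + p'); first exact: orthoD.
  exact: quotientD.
- move=> z _ [p Kpp <-]; exists (z *: p); first exact: orthoZ.
  exact: quotientZ.
move=> q; pose a := ip (\pi_Q x) (\pi_Q x).
rewrite -[q]reprK; set y := repr q.
exists (y <.> a); last exact: quotient_ract.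
have a0 k w : ideal_set K k -> a ** '<<k, w>> = 0.
  move=> Kk; rewrite /a -(ip_ract ipH) -quotient_ract.
  have -> : \pi_Q (x <.> '<<k, w>>) = 0.
    by rewrite -quotient0; apply/eq_quotient; rewrite subr0; exact: ideal_inner.
  by apply: (addrI (ip (\pi_Q x) 0)); rewrite -(ipDr ipH) !addr0.
have sa : star a = a by exact: (ip_star ipH).
move=> k Kk; rewrite inner_ractl sa; set c : B := '<<y, k>>.
(* Here [star d ** d] is a c (star c) a, and c (star c) = <k <k, y>, y> lies in <K, E>, which a
   kills. *)
rewrite -[LHS]starK; set d := star (a ** c); suff -> : d = 0 by rewrite star0.
apply: starM_eq0; rewrite /d starK starM sa amulA -(amulA a).
by rewrite -inner_ideal_sq a0 ?amul0l //; exact: ideal_inner.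
Qed.

(** * From a complement to a Hilbert structure on E/K *)

(** Forces every section of the quotient map with values in K^orth to be a module map. *)
Lemma ortho_inj p p' : Kp p -> Kp p' -> \pi_Q p = \pi_Q p' -> p = p'.
Proof.
move=> Kpp Kpp' /eq_quotient Kd; apply/eqP; rewrite -subr_eq0; apply/eqP.
by apply: ideal_ortho_eq0 => //; exact: orthoB.
Qed.

Lemma hilbert_of_complemented :
  complemented K -> exists ip : Q -> Q -> B, hilbert_product ip.
Proof.
move=> [split_x _].
have /choice[s sP] (q : Q) : exists p, Kp p /\ \pi_Q p = q.
  have [k [p [Kk Kpp xkp]]] := split_x (repr q).
  exists p; split=> //; rewrite -[RHS]reprK; apply/esym/eq_quotient.
  by rewrite xkp addrK.
have Ks q : Kp (s q) by have [] := sP q.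
have sK q : \pi_Q (s q) = q by have [] := sP q.
have sD q q' : s (q + q') = s q + s q'.
  by apply: ortho_inj; rewrite ?quotientD ?sK //; exact: orthoD.
have sZ (z : R[i]) q : s (z *: q) = z *: s q.
  by apply: ortho_inj; rewrite ?quotientZ ?sK //; exact: orthoZ.
have sR q b : s (q <.> b) = s q <.> b.
  by apply: ortho_inj; rewrite ?quotient_ract ?sK //; exact: ortho_ract.
have sN q : `|s q| = `|q| by rewrite -ortho_quotient_norm ?sK.
have sB q q' : s (q - q') = s q - s q'.
  by apply: ortho_inj; rewrite ?quotientB ?sK //; exact: orthoB.
have [iE _ _] := @innerP _ _ E.
exists (fun q q' => '<<s q, s q'>>); split.
- split=> [q q' q''|c q q'|q q' b|q q'|q|q /inner_eq0 q0].
  + by rewrite sD innerDr.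
  + by rewrite sZ innerZr.
  + by rewrite sR inner_ract.
  + exact: inner_star.
  + exact: (ip_ge0 iE).
  + by rewrite -[q]sK q0 quotient0.
- by move=> q; rewrite norm_inner sN sqrCK.
(* Completeness: the isometry [s] carries a Cauchy filter into E, and the contractive quotient map
   carries its limit back. *)
move=> F FP Fc.
have sFc : cauchy (s @ F).
  apply: cauchy_exP => e e0; have /cauchyP/(_ e e0)[q Fq] := Fc.
  exists (s q); rewrite /fmap /=; apply: (filterS _ Fq) => q' /=.
  by rewrite -!ball_normE /= -sB sN.
have sFx := hilbert_complete _ sFc; set x := lim _ in sFx.
apply/cvg_ex; exists (\pi_Q x); apply/cvg_ballP => e e0.
have : F (s @^-1` ball x e) by apply: sFx; exact: nbhsx_ballx.
apply: filterS => q.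
rewrite -!ball_normE /= -{2}[q]sK -quotientB => /le_lt_trans; apply.
exact: quotient_norm_le.
Qed.

End Orthocomplement.

Theorem theorem3p3 (R : realType) (B : cstarAlgType R) (E : hilbertModType B)
    (K : closedIdeal E) :
  (exists ip : quotient_module K -> quotient_module K -> B, hilbert_product ip)
  <-> complemented K.
Proof.
split=> [[ip]|]; first exact: complemented_of_hilbert.
exact: hilbert_of_complemented.
Qed.
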